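(* For every prime power $q$ of characteristic $p\ge3$, the number $I_{\mathrm{L}}(q)$ of $\mathbb{F}_q$-isomorphism classes of Legendre curves $E_{\mathrm{L},u}$, $u\in\mathbb{F}_q\setminus\{0,1\}$, is $$I_{\mathrm{L}}(q)=\begin{cases}\lfloor (7q+29)/24\rfloor,& q\equiv1\pmod{12},\\ \lfloor (q+2)/3\rfloor,& q\equiv3,7\pmod{12},\\ \lfloor (7q+13)/24\rfloor,& q\equiv5,9\pmod{12},\\ (q-2)/3,& q\equiv11\pmod{12}.\end{cases}$$
   Context: For $u\in\mathbb{F}_q\setminus\{0,1\}$, $E_{\mathrm{L},u}$ is the elliptic curve $Y^2=X(X-1)(X-u)$ over $\mathbb{F}_q$. Two elliptic curves in Weierstrass form are $\mathbb{F}_q$-isomorphic if one is transformed into the other by $X\mapsto\alpha^2\tilde X+\beta$, $Y\mapsto\alpha^3\tilde Y+\alpha^2\gamma\tilde X+\delta$ with $\alpha,\beta,\gamma,\delta\in\mathbb{F}_q$, $\alpha\ne0$. $I_{\mathrm{L}}(q)$ is the number of equivalence classes of the set $\{E_{\mathrm{L},u}: u\in\mathbb{F}_q\setminus\{0,1\}\}$ under $\mathbb{F}_q$-isomorphism. *)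

(* Defs.v *)
From HB Require Import structures.
From mathcomp Require Import all_boot all_order all_algebra all_field.
Set Implicit Arguments. Unset Strict Implicit. Unset Printing Implicit Defensive.
Import GRing.Theory.
Local Open Scope ring_scope.

(* Bivariate polynomials over F: outer variable = Y, inner variable = X. *)
Section Legendre.
Variable F : finFieldType.


Definition legendre_eq (u : F) : {poly {poly F}} :=
  'X ^+ 2 - (('X : {poly F}) * ('X - 1) * ('X - u%:P))%:P.

Definition weier_subst (a b c d : F) (P : {poly {poly F}}) : {poly {poly F}} :=
  (map_poly (fun r : {poly F} => r \Po (a ^+ 2 *: 'X + b%:P)) P)
    \Po ((a ^+ 3)%:P%:P * 'X + ((a ^+ 2 * c) *: 'X + d%:P)%:P).

(* E_{L,u} is F-isomorphic to E_{L,v}: some admissible substitution transforms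
   the equation of E_{L,u} into that of E_{L,v} (up to the unavoidable overall
   factor a^6 coming from Y^2 |-> a^6 Y^2 + ...). *)
Definition legendre_iso (u v : F) : bool :=
  [exists a : F, exists b : F, exists c : F, exists d : F,
     (a != 0) && (weier_subst a b c d (legendre_eq u) == (a ^+ 6)%:P%:P * legendre_eq v)].

Definition legendre_params : {set F} := [set u : F | (u != 0) && (u != 1)].

Definition legendre_classes : {set {set F}} :=
  [set [set v in legendre_params | legendre_iso u v] | u in legendre_params].

Definition I_L : nat := #|legendre_classes|.
End Legendre.

(* Main.v *)
Require Import Defs.
From HB Require Import structures.
From mathcomp Require Import all_boot all_order all_algebra all_field.
From mathcomp Require Import cyclic.
From mathcomp Require Import zify ring.
Set Implicit Arguments. Unset Strict Implicit. Unset Printing Implicit Defensive.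

(** An isomorphism between Legendre curves amounts to an affine map
    [x |-> s x + b], with [s] a nonzero square, carrying the roots [{0, 1, v}]
    onto [{0, 1, u}]; so the class of [u] consists of those of the six values
    [u, 1 - u, 1/u, 1 - 1/u, 1/(1 - u), 1 - 1/(1 - u)] whose scale factor is a
    square. The number of classes is the sum over [u] of [1/#|class u|].

    If [q = 3 mod 4], every class has 3 elements, except that the roots of
    [u^2 - u + 1] (j-invariant 0) form singletons. If [q = 1 mod 4], the size is
    6, 4, 4 or 2 according to which of [u] and [1 - u] are squares, with
    corrections at the roots of [u^2 - u + 1] and at [-1, 2, 1/2] (j-invariant
    1728). The map [u |-> 1 - u], and [u |-> 1/u] on non-squares, show that three
    of the four patterns are equally frequent, so no character sum is needed.
    Neither the number of roots of [u^2 - u + 1] nor the quadratic character of 2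
    has to be computed: divisibility by 24 (or 3) and the floors settle both. *)

Import GRing.Theory.
Local Open Scope ring_scope.

(** * Squares in a finite field of odd cardinality *)
Section Squares.
Variable F : finFieldType.
Implicit Types x y : F.

Definition is_square x : bool := [exists a, x == a ^+ 2].

Lemma is_squareX2 x : is_square (x ^+ 2).
Proof. by apply/existsP; exists x. Qed.

Lemma is_square1 : is_square 1.
Proof. by rewrite -[1](expr1n _ 2) is_squareX2. Qed.

Lemma finField_prim_root : exists z : F, #|F|.-1.-primitive_root z.
Proof.
have q1 : (1 < #|F|)%N := finNzRing_gt1 F.
have /hasP[z _ hz] : has #|F|.-1.-primitive_root (enum [pred x : F | x != 0]).
  apply: has_prim_root; [by lia | | exact: enum_uniq |].
    apply/allP => x; rewrite mem_enum inE => x0; rewrite unity_rootE.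
    by apply/eqP/(mulfI x0); rewrite -exprS prednK ?expf_card ?mulr1 //; lia.
  by rewrite -cardE (cardC1 0).
by exists z.
Qed.

Hypothesis qodd : odd #|F|.

(** As [#|F|.-1] is even, reducing an exponent modulo it preserves parity, so the quadratic
    character is the parity of the discrete logarithm. *)
Lemma is_square_prim_root (z : F) (i : nat) :
  #|F|.-1.-primitive_root z -> is_square (z ^+ i) = ~~ odd i.
Proof.
move=> pz; have q1 : (1 < #|F|)%N := finNzRing_gt1 F; have n0 := prim_order_gt0 pz.
apply/existsP/idP => [[a /eqP ha]|/even_halfK hi]; last first.
  by exists (z ^+ i./2); rewrite -exprM muln2 hi.
have a0 : a != 0.
  apply/negP => /eqP a0; move/eqP: ha.
  by rewrite a0 expr0n /= expf_eq0 (prim_root_eq0 pz) (gtn_eqF n0) andbF.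
have /(prim_rootP pz)[j aj] : a ^+ #|F|.-1 = 1.
  by apply: (mulfI a0); rewrite -exprS prednK ?expf_card ?mulr1 //; lia.
move/eqP: ha; rewrite aj -exprM (eq_prim_root_expr pz) => /eqP /(congr1 odd).
have ev : ~~ odd #|F|.-1 by lia.
have oddmod k : odd (k %% #|F|.-1) = odd k.
  by rewrite {2}(divn_eq k #|F|.-1) oddD oddM (negbTE ev) andbF.
by rewrite !oddmod muln2 odd_double => ->.
Qed.

Lemma unit_prim_root (z x : F) :
  #|F|.-1.-primitive_root z -> x != 0 -> exists i, x = z ^+ i.
Proof.
move=> pz x0; have q1 : (1 < #|F|)%N := finNzRing_gt1 F.
have /(prim_rootP pz)[j xj] : x ^+ #|F|.-1 = 1.
  by apply: (mulfI x0); rewrite -exprS prednK ?expf_card ?mulr1 //; lia.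
by exists j.
Qed.

Lemma is_squareM x y : x != 0 -> y != 0 ->
  is_square (x * y) = (is_square x == is_square y).
Proof.
have [z pz] := finField_prim_root.
move=> /(unit_prim_root pz)[i ->] /(unit_prim_root pz)[j ->].
by rewrite -exprD !(is_square_prim_root _ pz) oddD; case: (odd i) (odd j) => [] [].
Qed.

Lemma is_squareV x : is_square x^-1 = is_square x.
Proof.
by apply/existsP/existsP => -[a /eqP ha]; exists a^-1; rewrite exprVn -ha ?invrK.
Qed.

Lemma is_squareN1 : is_square (-1) = (#|F| %% 4 == 1)%N.
Proof.
have [z pz] := finField_prim_root; have q1 : (1 < #|F|)%N := finNzRing_gt1 F.
(* By primitivity this power is a square root of 1 other than 1. Its exponent is even exactly when
   [q = 1 mod 4]. *)
have zh : z ^+ (#|F|.-1)./2 = -1.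
  have : (z ^+ (#|F|.-1)./2) ^+ 2 == 1.
    by rewrite -exprM muln2 even_halfK ?(prim_expr_order pz) //; lia.
  rewrite sqrf_eq1 => /orP[|/eqP//].
  by rewrite -[X in _ == X](expr0 z) (eq_prim_root_expr pz) mod0n modn_small; lia.
by rewrite -zh is_square_prim_root //; lia.
Qed.

(** Multiplication by the non-square [z] maps the nonzero squares bijectively onto the
    non-squares. *)
Lemma card_squares : #|[set x : F | (x != 0) && is_square x]| = #|F|.-1./2.
Proof.
have [z pz] := finField_prim_root; have q1 : (1 < #|F|)%N := finNzRing_gt1 F.
have z0 : z != 0 by rewrite (prim_root_eq0 pz); lia.
have zns : is_square z = false by rewrite -[z]expr1 (is_square_prim_root _ pz).
set S := [set x | _].
have E : [set x : F | (x != 0) && ~~ is_square x] = [set z * x | x in S].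
  apply/setP => x; rewrite inE; apply/andP/imsetP => [[x0 nx]|[y]].
    exists (z^-1 * x); last by rewrite mulrA mulfV // mul1r.
    by rewrite inE mulf_neq0 ?invr_eq0 // is_squareM ?invr_eq0 // is_squareV zns (negbTE nx).
  rewrite inE => /andP[y0 sy] ->; rewrite mulf_neq0 //; split=> //.
  by rewrite is_squareM // zns sy.
have cE : #|[set x : F | (x != 0) && ~~ is_square x]| = #|S|.
  by rewrite E card_imset //; exact: mulfI.
have : #|[set~ (0 : F)]| = (#|S| + #|S|)%N.
  rewrite -{2}cE -cardsUI (_ : S :&: _ = set0) ?cards0 ?addn0.
    by apply: eq_card => x; rewrite !inE; case: (x == 0); case: is_square.
  by apply/setP => x; rewrite !inE; case: (x == 0); case: is_square.
by rewrite cardsC1 addnn => ->; rewrite doubleK.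
Qed.

End Squares.

(** * Isomorphisms as affine maps of the roots *)
Section LegendreIso.
Variable F : finFieldType.
Implicit Types u v s b : F.
Hypothesis two_neq0 : 2 != 0 :> F.

Definition legendre_roots u : {set F} := [set 0; 1; u].

Definition legendre_cubic u : {poly F} := 'X * ('X - 1) * ('X - u%:P).

Lemma legendre_cubicE u : u \in legendre_params F ->
  legendre_cubic u = \prod_(x in legendre_roots u) ('X - x%:P).
Proof.
rewrite inE => /andP[u0 u1]; rewrite /legendre_cubic /legendre_roots setUC.
rewrite big_setU1 ?big_setU1 /= ?big_set1 ?inE ?negb_or ?u0 ?u1 //; last by rewrite eq_sym oner_eq0.
by rewrite subr0 mulrC.
Qed.

Lemma mem_root_legendre_cubic u x : root (legendre_cubic u) x = (x \in legendre_roots u).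
Proof.
rewrite !inE /root /legendre_cubic !hornerE !mulf_eq0 !subr_eq0.
by [].
Qed.

Lemma card_legendre_roots u : u \in legendre_params F -> #|legendre_roots u| = 3%N.
Proof.
rewrite inE => /andP[u0 u1]; rewrite /legendre_roots cardsU cards2 cards1.
rewrite eq_sym oner_eq0 (_ : _ :&: _ = set0) ?cards0 //.
apply/setP => x; rewrite !inE; apply/negP => /andP[/orP[]/eqP-> /eqP E].
  by rewrite -E eqxx in u0.
by rewrite -E eqxx in u1.
Qed.

Lemma weier_subst_legendre (a b c d u : F) :
  weier_subst a b c d (legendre_eq u) =
  ((a ^+ 3)%:P%:P * 'X + ((a ^+ 2 * c) *: 'X + d%:P)%:P) ^+ 2
  - (legendre_cubic u \Po (a ^+ 2 *: 'X + b%:P))%:P.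
Proof.
rewrite /weier_subst /legendre_eq -/(legendre_cubic u).
set g := (fun r : {poly F} => _).
have -> : map_poly g ('X^2 - (legendre_cubic u)%:P) = 'X^2 - (g (legendre_cubic u))%:P.
  by rewrite [LHS]rmorphB /= map_polyXn map_polyC.
by rewrite rmorphB rmorphXn /= comp_polyX comp_polyC.
Qed.

(** As 2 is invertible, the term linear in [Y] forces [c = d = 0], and only the comparison of the
    cubics in [X] remains. *)
Lemma weier_subst_legendre_eq (a b c d u v : F) : a != 0 ->
  weier_subst a b c d (legendre_eq u) = (a ^+ 6)%:P%:P * legendre_eq v ->
  legendre_cubic u \Po (a ^+ 2 *: 'X + b%:P) = a ^+ 6 *: legendre_cubic v.
Proof.
move=> a0; rewrite weier_subst_legendre /legendre_eq -/(legendre_cubic v).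
move: (_ \Po _) (legendre_cubic v) (_ *: 'X + d%:P) => A B l H.
have h0 := congr1 (fun p : {poly {poly F}} => p.[0]) H.
have h1 := congr1 (fun p : {poly {poly F}} => p.[1]) H.
have hN := congr1 (fun p : {poly {poly F}} => p.[-1]) H.
rewrite /= !hornerE /= in h0 h1 hN; rewrite mulrN1 in hN.
(* Comparing the values at [Y = 1] and [Y = -1] kills the linear term in [Y]. *)
have l0 : l = 0.
  have : (4 * a ^+ 3)%:P * l = 0.
    rewrite polyCM.
    transitivity (((a ^+ 3)%:P + l) ^+ 2 - A - ((- (a ^+ 3)%:P + l) ^+ 2 - A)).
      by rewrite (_ : 4%:P = 4) ?rmorph_nat //; ring.
    by rewrite h1 hN; ring.
  move/eqP; rewrite mulf_eq0 polyC_eq0 mulf_eq0 expf_eq0 (negbTE a0) /=.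
  by rewrite (_ : 4 = 2 * 2 :> F) ?mulf_eq0 ?(negbTE two_neq0) /= -?natrM // => /eqP.
move: h0; rewrite l0 -mul_polyC => h0; apply: oppr_inj.
transitivity (0 ^+ 2 - A); first by ring.
by rewrite h0; ring.
Qed.

Definition affine s b : F -> F := fun x => s * x + b.

Lemma affine_inj s b : s != 0 -> injective (affine s b).
Proof. by move=> s0 x y /addIr /(mulfI s0). Qed.

(** An injective image contained in a set of the same size 3 fills it. *)
Lemma legendre_roots_imset s b u v : s != 0 ->
  u \in legendre_params F -> v \in legendre_params F ->
  {in legendre_roots v, forall x, affine s b x \in legendre_roots u} ->
  affine s b @: legendre_roots v = legendre_roots u.
Proof.
move=> s0 hu hv H; apply/eqP; rewrite eqEcard card_imset ?card_legendre_roots ?leqnn ?andbT //.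
  by apply/subsetP => y /imsetP[x xv ->]; exact: H.
exact: affine_inj.
Qed.

Lemma legendre_isoP u v : u \in legendre_params F -> v \in legendre_params F ->
  reflect (exists s b, [/\ s != 0, is_square s
     & affine s b @: legendre_roots v = legendre_roots u])
    (legendre_iso u v).
Proof.
move=> hu hv; apply: (iffP existsP).
  case=> a /existsP[b /existsP[c /existsP[d /andP[a0 /eqP H]]]].
  exists (a ^+ 2), b; split; rewrite ?expf_neq0 ?is_squareX2 //.
  apply: legendre_roots_imset; rewrite ?expf_neq0 //.
  move=> x xv; have := congr1 (fun p : {poly F} => p.[x]) (weier_subst_legendre_eq a0 H).
  move: xv; rewrite -!mem_root_legendre_cubic /root => /eqP xv.
  by rewrite /affine horner_comp hornerZ xv mulr0 !(hornerD, hornerZ, hornerX, hornerC) => ->.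
case=> s [b [s0 /existsP[a /eqP sa] E]].
(* A square root of the scale factor serves as [a], with [c = d = 0]. *)
exists a; apply/existsP; exists b; apply/existsP; exists 0; apply/existsP; exists 0.
have a0 : a != 0 by apply: contraNneq s0 => a0; rewrite sa a0 expr0n.
rewrite a0 weier_subst_legendre mulr0 scale0r add0r polyC0 addr0.
suff -> : legendre_cubic u \Po (a ^+ 2 *: 'X + b%:P) = a ^+ 6 *: legendre_cubic v.
  rewrite /legendre_eq -/(legendre_cubic v) -mul_polyC polyCM; apply/eqP.
  have -> : (a ^+ 6)%:P%:P = (a ^+ 3)%:P%:P ^+ 2 :> {poly {poly F}}.
    by rewrite -!polyC_exp -exprM.
  ring.
(* Both cubics become products over the roots of [v], reindexed by the affine map; each of the three
   factors yields one [s], and [s^3 = a^6]. *)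
rewrite !legendre_cubicE // -E big_imset /=; last by move=> x y _ _; apply: affine_inj.
rewrite rmorph_prod /= (_ : a ^+ 6 = \prod_(x in legendre_roots v) s); last first.
  by rewrite prodr_const card_legendre_roots // sa -exprM.
rewrite -scaler_prod; apply: eq_bigr => x _.
rewrite /affine rmorphB /= comp_polyX comp_polyC -sa polyCD polyCM -!mul_polyC; ring.
Qed.

(** Affine maps with nonzero square scale are closed under inverse and composition. *)
Lemma legendre_iso_equiv :
  {in legendre_params F & &, equivalence_rel (@legendre_iso F)}.
Proof.
have refl u : u \in legendre_params F -> legendre_iso u u.
  move=> hu; apply/legendre_isoP => //; exists 1, 0; split; first exact: oner_neq0.
    exact: is_square1.
  by rewrite -[RHS]imset_id; apply: eq_imset => x; rewrite /affine mul1r addr0.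
have sym u v : u \in legendre_params F -> v \in legendre_params F ->
    legendre_iso u v -> legendre_iso v u.
  move=> hu hv /legendre_isoP -/(_ hu hv) [s [b [s0 qs E]]].
  apply/legendre_isoP => //; exists s^-1, (- (s^-1 * b)).
  split; rewrite ?invr_eq0 ?is_squareV //.
  rewrite -E -imset_comp -[RHS]imset_id.
  by apply: eq_imset => x; rewrite /affine /=; field.
have trans u v w : u \in legendre_params F -> v \in legendre_params F ->
    w \in legendre_params F -> legendre_iso u v -> legendre_iso v w -> legendre_iso u w.
  move=> hu hv hw /legendre_isoP -/(_ hu hv) [s [b [s0 /existsP[a /eqP qs] E]]].
  move=> /legendre_isoP -/(_ hv hw) [t [c [t0 /existsP[e /eqP qt] E']]].
  apply/legendre_isoP => //; exists (s * t), (s * c + b).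
  split; first exact: mulf_neq0.
    by rewrite qs qt -exprMn is_squareX2.
  rewrite -E -E' -imset_comp.
  by apply: eq_imset => x; rewrite /affine /=; ring.
move=> u v w hu hv hw; split; first exact: refl.
move=> uv; apply/idP/idP => [uw|vw]; last exact: (trans u v w).
exact: (trans v u w hv hu hw (sym u v hu hv uv)).
Qed.

(** If 0, 1, [v] go to [r0], [r1], [r2], the scale is [r1 - r0] and [v = (r2 - r0) / (r1 - r0)]. The
    six orderings of 0, 1, [u] give the six disjuncts. *)
Lemma legendre_isoE u v : u \in legendre_params F -> v \in legendre_params F ->
  legendre_iso u v =
  [|| v == u, is_square (-1 : F) && (v == 1 - u),
      is_square u && (v == u^-1), is_square (- u) && (v == 1 - u^-1),
      is_square (u - 1) && (v == (1 - u)^-1) |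
      is_square (1 - u) && (v == 1 - (1 - u)^-1)].
Proof.
move=> hu hv; move: (hu) (hv); rewrite !inE => /andP[u0 u1] /andP[v0 v1].
have u1' : 1 - u != 0 by rewrite subr_eq0 eq_sym.
apply/(legendre_isoP hu hv)/idP; last first.
  have mem s b : s != 0 -> is_square s -> b \in legendre_roots u ->
      s + b \in legendre_roots u -> s * v + b \in legendre_roots u ->
      exists s b, [/\ s != 0, is_square s
     & affine s b @: legendre_roots v = legendre_roots u].
    move=> s0 qs b0 b1 bv; exists s, b; split=> //; apply: legendre_roots_imset => // x.
    rewrite /affine !inE in b0 b1 bv *.
    by case/orP => [/orP[]|] /eqP->; rewrite ?mulr0 ?mulr1 ?add0r.
  case/orP => [/eqP vu | ].
    apply: (mem 1 0); rewrite ?oner_neq0 ?mul1r ?addr0 ?vu ?inE ?eqxx ?orbT //.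
    exact: is_square1.
  case/or4P => [/andP[q /eqP vu]|/andP[q /eqP vu]|/andP[q /eqP vu]|/orP[]/andP[q /eqP vu]].
  - apply: (mem (-1) 1); rewrite ?oppr_eq0 ?oner_neq0 // ?inE ?eqxx ?orbT ?addNr ?eqxx //.
    by rewrite vu (_ : -1 * _ + 1 = u) ?eqxx ?orbT //; ring.
  - by apply: (mem u 0); rewrite ?inE ?addr0 ?vu ?mulfV ?eqxx ?orbT.
  - apply: (mem (- u) u); rewrite ?oppr_eq0 ?inE ?addNr ?eqxx ?orbT //.
    by rewrite vu (_ : _ + _ = 1) ?eqxx ?orbT //; field.
  - apply: (mem (u - 1) 1); rewrite ?subr_eq0 ?inE ?subrK ?eqxx ?orbT //.
    by rewrite vu (_ : _ + _ = 0) ?eqxx ?orbT //; field.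
  - apply: (mem (1 - u) u); rewrite ?inE ?subrK ?eqxx ?orbT //.
    by rewrite vu (_ : _ + _ = 0) ?eqxx ?orbT //; field.
case=> s [b [s0 qs E]].
have img x : x \in legendre_roots v -> affine s b x \in legendre_roots u.
  by move=> xv; rewrite -E; apply: imset_f.
have := img v; have := img 1; have := img 0.
rewrite !inE !eqxx ?orbT /affine mulr0 add0r mulr1 => /(_ isT) Hb /(_ isT) H1 /(_ isT) Hv.
have n1 : s + b != b by rewrite -subr_eq0 addrK.
have n2 : s * v + b != b by rewrite -subr_eq0 addrK mulf_neq0.
have n3 : s * v + b != s + b.
  by rewrite (inj_eq (addIr b)) -[X in _ != X]mulr1 (inj_eq (mulfI s0)).
have sE : s = s + b - b by rewrite addrK.
have vE : v = (s * v + b - b) / (s + b - b) by rewrite !addrK mulrC mulKf.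
move: qs s0; rewrite {1 2}sE; move: (s + b) (s * v + b) Hb H1 Hv n1 n2 n3 vE => x y.
move=> + + + + + + ->.
(* Of the 27 assignments of roots, distinctness leaves the six orderings. *)
case/orP => [/orP[]|] /eqP->; case/orP => [/orP[]|] /eqP-> //;
  case/orP => [/orP[]|] /eqP->; rewrite ?eqxx //= => _ _ _; rewrite ?subr0 ?sub0r => q s0.
- by rewrite divr1 eqxx.
- by rewrite q mul1r eqxx !orbT.
- by rewrite q (_ : _ / _ = 1 - u) ?eqxx ?orbT //; field.
- by rewrite q (_ : _ / _ = (1 - u)^-1) ?eqxx ?orbT //; field; apply/andP.
- by rewrite q (_ : _ / _ = 1 - u^-1) ?eqxx ?orbT //; field; rewrite ?oppr_eq0 ?u0 ?u1'.
- by rewrite q (_ : _ / _ = 1 - (1 - u)^-1) ?eqxx ?orbT //; field; rewrite ?oppr_eq0 ?u0 ?u1'.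
Qed.
End LegendreIso.

(** * Class sizes *)
(** The weight plays the role of [m] divided by the class size, so each class contributes [m] in
    total and no fraction appears. *)
Lemma sum_class_weight (T : finType) (R : rel T) (D : {set T}) (w : T -> nat) (m : nat) :
    {in D & &, equivalence_rel R} ->
    {in D, forall x, #|[set y in D | R x y]| * w x = m}%N ->
  (m * #|equivalence_partition R D| = \sum_(x in D) w x)%N.
Proof.
move=> eR hw; have PD := equivalence_partitionP eR.
rewrite (set_partition_big _ PD) /= mulnC -sum_nat_const.
apply: eq_bigr => B /imsetP[x xD ->].
rewrite -(hw x xD) -sum_nat_const; apply: eq_bigr => y; rewrite inE => /andP[yD Rxy].
have E : [set z in D | R x z] = [set z in D | R y z].
  apply/setP => z; rewrite !inE; case zD: (z \in D) => //=.
  by have [_ ->] := eR x y z xD yD zD.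
(* Equivalent elements share their class; cancelling its positive size equates their weights. *)
have /eqP := hw y yD; rewrite -(hw x xD) E eqn_pmul2l => [/eqP -> //|].
by apply/card_gt0P; exists y; rewrite inE yD; have [->] := eR y y y yD yD yD.
Qed.

Lemma sum_nat_pred (T : finType) (D : {set T}) (P : pred T) :
  (\sum_(x in D) P x = #|[set x in D | P x]|)%N.
Proof.
rewrite -sum1_card big_mkcond [RHS]big_mkcond /=.
by apply: eq_bigr => x _; rewrite inE; case: (x \in D); case: (P x).
Qed.

Lemma sum_nat_pred1 (T : finType) (D : {set T}) (a : T) : a \in D ->
  (\sum_(x in D) (x == a) = 1)%N.
Proof.
move=> aD; rewrite sum_nat_pred -(cards1 a); apply: eq_card => x.
by rewrite !inE andbC; case: eqP => // ->.
Qed.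

(** Reduces each inequality between two of the six values to a [ring] or [field] identity with an
    explicit cofactor [k]. *)
Lemma neq_factor (R : pzRingType) (x y k w : R) : w != 0 -> w = (x - y) * k -> x != y.
Proof. by move=> w0 e; apply: contraNneq w0 => xy; rewrite e xy subrr mul0r. Qed.

(** * Weighted counting of parameters, and the parameters of j-invariant 0 *)

Section Counting.
Variable F : finFieldType.
Implicit Types u v : F.
Hypothesis two_neq0 : 2 != 0 :> F.
Hypothesis qodd : odd #|F|.

Notation sq := (@is_square F).
Notation D := (legendre_params F).

Definition legendre_class u : {set F} := [set v in D | legendre_iso u v].

(* The parameters of j-invariant 0. *)
Definition hexagonal : {set F} := [set u | u ^+ 2 - u + 1 == 0].

(** 12 is the least common multiple of the class sizes that can occur: 1, 2, 3, 4, 6. *)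
Lemma I_L_weight (w : F -> nat) : {in D, forall u, #|legendre_class u| * w u = 12}%N ->
  (12 * I_L F = \sum_(u in D) w u)%N.
Proof. exact: (sum_class_weight (legendre_iso_equiv two_neq0)). Qed.

Lemma paramsN u : (1 - u \in D) = (u \in D).
Proof.
have e : (1 - u == 1) = (u == 0) by rewrite -subr_eq0 addrAC subrr add0r oppr_eq0.
by rewrite !inE e subr_eq0 [1 == u]eq_sym andbC.
Qed.

Lemma paramsV u : (u^-1 \in D) = (u \in D).
Proof. by rewrite !inE invr_eq0 invr_eq1. Qed.

Lemma card_params : #|D| = (#|F| - 2)%N.
Proof.
have -> : D = ~: [set 0; 1] by apply/setP => u; rewrite !inE negb_or.
by rewrite cardsCs setCK cards2 eq_sym oner_eq0.
Qed.

Lemma hexagonal_params u : u \in hexagonal -> u \in D.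
Proof.
rewrite !inE => h; apply/andP; split; apply: contraTneq h => ->.
  by rewrite expr0n subrr add0r oner_eq0.
by rewrite expr1n subrr add0r oner_eq0.
Qed.

Lemma hexagonal_eq u : u \in hexagonal -> hexagonal = [set u; 1 - u].
Proof.
rewrite inE => /eqP hu; apply/setP => v; rewrite !inE.
have -> : v ^+ 2 - v + 1 = (v - u) * (v - (1 - u)) + (u ^+ 2 - u + 1) by ring.
by rewrite hu addr0 mulf_eq0 !subr_eq0.
Qed.

Lemma card_hexagonal_le2 : (#|hexagonal| <= 2)%N.
Proof.
case: (set_0Vmem hexagonal) => [->|[u hu]]; first by rewrite cards0.
by rewrite (hexagonal_eq hu) cards2; case: (_ != _).
Qed.

Lemma card_hexagonal : 3 != 0 :> F -> (#|hexagonal| = 0 \/ #|hexagonal| = 2)%N.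
Proof.
move=> three_neq0; case: (set_0Vmem hexagonal) => [->|[u hu]]; first by left; rewrite cards0.
right; rewrite (hexagonal_eq hu) cards2; case: eqP => // e.
move: hu; rewrite inE => /eqP hu; case/eqP: three_neq0.
(* The discriminant of [u^2 - u + 1] is -3, so a double root would force [3 = 0]. *)
transitivity ((2 * u - 1) * (1 - 2 * u) + 4 * (u ^+ 2 - u + 1)); first by ring.
rewrite hu mulr0 addr0 (_ : 2 * u = 1) ?subrr ?mul0r //.
by transitivity (u + (1 - u)); first rewrite -e; ring.
Qed.

Lemma sum_hexagonal : (\sum_(u in D) (u \in hexagonal) = #|hexagonal|)%N.
Proof.
rewrite sum_nat_pred; apply: eq_card => u; rewrite [LHS]inE andbC.
by case h: (u \in hexagonal); rewrite ?(hexagonal_params h).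
Qed.

(** Here [u * (1 - u) = 1], so the six values collapse to [u] and [1 - u]. *)
Lemma hexagonalV u : u \in hexagonal -> (u^-1 = 1 - u) * ((1 - u)^-1 = u).
Proof.
move=> hu; have := hexagonal_params hu; rewrite !inE => /andP[u0 u1].
have e : u * (1 - u) = 1.
  by move: hu; rewrite inE => /eqP hu; rewrite -[RHS]subr0 -hu; ring.
have u1' : 1 - u != 0 by rewrite subr_eq0 eq_sym.
split; first by apply: (mulfI u0); rewrite e mulfV.
by apply: (mulIf u1'); rewrite e mulVf.
Qed.

(** * The quadratic character of -1, and the case [q = 3 mod 4] *)

Lemma is_squareN u : u != 0 -> sq (- u) = (sq (-1) == sq u).
Proof. by move=> u0; rewrite -(mulN1r u) is_squareM // ?oppr_eq0 ?oner_neq0. Qed.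

Lemma is_squareBC u : u \in D -> sq (u - 1) = (sq (-1) == sq (1 - u)).
Proof. by rewrite -paramsN inE => /andP[u0 _]; rewrite -is_squareN // opprB. Qed.

(** With -1 a non-square, exactly one of [u], [- u] is a square, and exactly one of [u - 1],
    [1 - u]; this selects three of the six values. *)
Lemma legendre_class_3mod4 u : ~~ sq (-1) -> u \in D ->
  legendre_class u =
  [set u; if sq u then u^-1 else 1 - u^-1;
       if sq (1 - u) then 1 - (1 - u)^-1 else (1 - u)^-1].
Proof.
move=> n1 hu; apply/setP => v; rewrite inE; have := hu; rewrite inE => /andP[u0 u1].
transitivity ((v \in D) && (v \in [set u; if sq u then u^-1 else 1 - u^-1;
       if sq (1 - u) then 1 - (1 - u)^-1 else (1 - u)^-1])).
  case hv: (v \in D) => //=; rewrite legendre_isoE // is_squareN // is_squareBC //.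
  rewrite (negbTE n1) !inE /= -!orbA.
  by case: (sq u); case: (sq (1 - u)); rewrite /= ?orbF.
rewrite andb_idl // => /setUP[/set2P[]|/set1P] ->; try case: ifP => _;
  by rewrite ?paramsN ?paramsV ?paramsN.
Qed.

Lemma card_legendre_class_3mod4 u : ~~ sq (-1) -> u \in D ->
  #|legendre_class u| = if u \in hexagonal then 1%N else 3%N.
Proof.
move=> n1 hu; rewrite legendre_class_3mod4 //; have := hu; rewrite inE => /andP[u0 u1].
have u1' : 1 - u != 0 by rewrite subr_eq0 eq_sym.
case hex: (u \in hexagonal).
  have [eV e1V] := hexagonalV hex.
  have ns : ~~ sq u.
    (* Here [u^3 = -1], so [u = a^2] would give [(a^3)^2 = -1]. *)
    apply: contra n1 => /existsP[a /eqP ua]; apply/existsP; exists (a ^+ 3).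
    rewrite -exprM mulnC exprM -ua -subr_eq0.
    rewrite (_ : _ - _ = - (u + 1) * (u ^+ 2 - u + 1)); last by ring.
    by move: hex; rewrite inE mulf_eq0 => ->; rewrite orbT.
  have ns' : ~~ sq (1 - u) by rewrite -eV is_squareV.
  by rewrite (negbTE ns) (negbTE ns') eV e1V subKr !setUid cards1.
have {}hex : u ^+ 2 - u + 1 != 0 by rewrite inE in hex; rewrite hex.
have sqV (x : F) : x != 0 -> x != 1 -> sq x -> x != x^-1.
  move=> x0 x1 sx; apply: contra n1 => /eqP xV.
  suff /eqP <- : x == -1 by [].
  have : x ^+ 2 == 1 by rewrite expr2 {2}xV mulfV.
  by rewrite sqrf_eq1 (negbTE x1).
have n1u : 1 - u != 1 by have := hu; rewrite -paramsN inE => /andP[].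
(* The pair [u^-1], [(1 - u)^-1] and the pair of their complements to 1 arise only when [u] and
   [1 - u] differ in character. *)
have uN : sq u != sq (1 - u) -> u != 1 - u by apply: contraNneq => <-.
suff [ab ac bc] : [/\ u != (if sq u then u^-1 else 1 - u^-1),
    u != (if sq (1 - u) then 1 - (1 - u)^-1 else (1 - u)^-1) &
    (if sq u then u^-1 else 1 - u^-1) != (if sq (1 - u) then 1 - (1 - u)^-1 else (1 - u)^-1)].
  by rewrite -setUA cardsU1 cards2 bc !inE negb_or ab ac.
have hexE x y k : u ^+ 2 - u + 1 = (x - y) * k -> x != y by exact: neq_factor.
(* The letters [a], [c], [d], [e], [f] denote [u], [u^-1], [1 - u^-1], [(1 - u)^-1],
   [1 - (1 - u)^-1]. Each of these four coincidences would force [u^2 - u + 1 = 0]. *)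
have ad : u != 1 - u^-1 by apply: (@hexE _ _ u); field.
have ae : u != (1 - u)^-1 by apply: (@hexE _ _ (u - 1)); field.
have cf : u^-1 != 1 - (1 - u)^-1 by apply: (@hexE _ _ (u * (1 - u))); field; apply/andP.
have de : 1 - u^-1 != (1 - u)^-1 by apply: (@hexE _ _ (- (u * (1 - u)))); field; apply/andP.
have af : sq (1 - u) -> u != 1 - (1 - u)^-1.
  by move=> s; rewrite -(inj_eq (@subrI _ 1)) subKr sqV.
have N1 (x y : F) : (1 - x == 1 - y) = (x == y) by rewrite (inj_eq (@subrI _ 1)).
case E: (sq u) uN; case E': (sq (1 - u)) af => af uN; split=> //;
  by rewrite ?N1 ?(inj_eq invr_inj) ?uN ?sqV ?af.
Qed.

Lemma I_L_3mod4 : (#|F| %% 4 = 3 -> 3 * I_L F = #|F| - 2 + 2 * #|hexagonal|)%N.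
Proof.
move=> q3; have n1 : ~~ sq (-1) by rewrite is_squareN1 // q3.
(* The weight is 12/3 = 4 in general and 12/1 = 4 + 8 at j-invariant 0. *)
have := @I_L_weight (fun u => 4 + 8 * (u \in hexagonal))%N.
rewrite big_split /= sum_nat_const -big_distrr sum_hexagonal card_params => H.
suff : (12 * I_L F = (#|F| - 2) * 4 + 8 * #|hexagonal|)%N.
  by move: (I_L F) #|F| #|hexagonal| => i q t; lia.
apply: H => u hu; rewrite card_legendre_class_3mod4 //.
by case: (_ \in _).
Qed.

(** * The case [q = 1 mod 4] *)

Lemma legendre_class_1mod4 u : sq (-1) -> u \in D ->
  legendre_class u =i [:: u; 1 - u]
    ++ (if sq u then [:: u^-1; 1 - u^-1] else [::])
    ++ (if sq (1 - u) then [:: (1 - u)^-1; 1 - (1 - u)^-1] else [::]).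
Proof.
move=> s1 hu v; rewrite inE; have := hu; rewrite inE => /andP[u0 u1].
set s := _ ++ _.
transitivity ((v \in D) && (v \in s)).
  (* As -1 is a square, signs drop out of the square conditions. *)
  case hv: (v \in D) => //=; rewrite legendre_isoE // is_squareN // is_squareBC //.
  rewrite s1 /s; case: (sq u); case: (sq (1 - u)); rewrite !inE ?orbF //= -?orbA //.
rewrite andb_idl // /s !mem_cat => /or3P[]; try case: ifP => _;
  by rewrite ?in_nil // mem_seq2 => /orP[] /eqP->; rewrite ?paramsN ?paramsV ?paramsN.
Qed.

Lemma card_legendre_class u (s : seq F) : uniq s -> legendre_class u =i s ->
  #|legendre_class u| = size s.
Proof. by move=> /card_uniqP <- /eq_card. Qed.

(** Each of the 15 coincidences among the six values would make one of [u^2 - u + 1], [u + 1],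
    [u - 2], [2 * u - 1] vanish. *)
Lemma card_legendre_class_1mod4 u : sq (-1) -> u \in D -> u \notin hexagonal ->
    u != -1 -> u != 2 -> u != 2^-1 ->
  #|legendre_class u| = (2 + 2 * sq u + 2 * sq (1 - u)%R)%N.
Proof.
move=> s1 hu hex uN1 u2 uh; rewrite (@card_legendre_class u _ _ (legendre_class_1mod4 s1 hu)).
  by case: (sq u); case: (sq (1 - u)).
have := hu; rewrite inE => /andP[u0 u1].
have u1' : 1 - u != 0 by rewrite subr_eq0 eq_sym.
have u1n : u - 1 != 0 by rewrite subr_eq0.
have {}hex : u ^+ 2 - u + 1 != 0 by rewrite inE in hex.
have {}uN1 : u + 1 != 0 by rewrite addr_eq0.
have {}u2 : u - 2 != 0 by rewrite subr_eq0.
have {}uh : 2 * u - 1 != 0.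
  apply: contraNneq uh => /eqP; rewrite subr_eq0 => /eqP e.
  by apply/eqP/(mulfI two_neq0); rewrite e mulfV.
have u1u := mulf_neq0 u0 u1'.
have ab : u != 1 - u by apply: (neq_factor (k := 1) uh); ring.
have ac : u != u^-1 by apply: (neq_factor (k := u / (u - 1)) uN1); field; apply/andP.
have ad : u != 1 - u^-1 by apply: (neq_factor (k := u) hex); field.
have ae : u != (1 - u)^-1 by apply: (neq_factor (k := u - 1) hex); field.
have af : u != 1 - (1 - u)^-1 by apply: (neq_factor (k := (u - 1) / u) u2); field; apply/andP.
have bc : 1 - u != u^-1 by apply: (neq_factor (k := - u) hex); field.
have bd : 1 - u != 1 - u^-1 by apply: (neq_factor (k := - u / (u - 1)) uN1); field; apply/andP.
have be : 1 - u != (1 - u)^-1 by apply: (neq_factor (k := (1 - u) / u) u2); field; apply/andP.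
have bf : 1 - u != 1 - (1 - u)^-1 by apply: (neq_factor (k := 1 - u) hex); field.
have cd : u^-1 != 1 - u^-1 by apply: (neq_factor (k := - u) u2); field.
have ce : u^-1 != (1 - u)^-1 by apply: (neq_factor (k := - (u * (1 - u))) uh); field; apply/andP.
have cf : u^-1 != 1 - (1 - u)^-1 by apply: (neq_factor (k := u * (1 - u)) hex); field; apply/andP.
have de : 1 - u^-1 != (1 - u)^-1 by apply: (neq_factor (k := - (u * (1 - u))) hex); field; apply/andP.
have df : 1 - u^-1 != 1 - (1 - u)^-1 by apply: (neq_factor (k := u * (1 - u)) uh); field; apply/andP.
have ef : (1 - u)^-1 != 1 - (1 - u)^-1 by apply: (neq_factor (k := 1 - u) uN1); field.
by case: (sq u); case: (sq (1 - u)); rewrite /= !inE ?negb_or ?ab ?ac ?ad ?ae ?af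
  ?bc ?bd ?be ?bf ?cd ?ce ?cf ?de ?df ?ef.
Qed.

(* [12 / #|legendre_class u|] away from the j-invariants 0 and 1728, for [q = 1 mod 4]. *)
Definition generic_weight u : nat :=
  (if sq u then if sq (1 - u)%R then 2 else 3 else if sq (1 - u)%R then 3 else 6)%N.

Lemma generic_weightE u :
  ((2 + 2 * sq u + 2 * sq (1 - u)%R) * generic_weight u = 12)%N.
Proof. by rewrite /generic_weight; case: (sq u); case: (sq (1 - u)). Qed.

Lemma subN1 : 1 - -1 = 2 :> F. Proof. by rewrite opprK. Qed.

Lemma sub12 : 1 - 2 = -1 :> F. Proof. ring. Qed.

Lemma subhalf : 1 - 2^-1 = 2^-1 :> F. Proof. by field. Qed.

Lemma special_params : [/\ -1 \in D, 2 \in D & 2^-1 \in D].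
Proof.
suff h : 2 \in D by split; rewrite ?paramsV // -sub12 paramsN.
by rewrite inE two_neq0 -subr_eq0 (_ : 2 - 1 = 1) ?oner_neq0 //; ring.
Qed.

(** Each correction is 12 over the true size minus the generic weight. Roots of [u^2 - u + 1]: 6 -
    2. If 2 is a square, -1, 2, 1/2 form one class: 4 - 2 each. Otherwise [{-1, 2}] gives 6 - 3 and
    [{1/2}] gives 12 - 6. *)
Lemma legendre_class_weight_1mod4 u : 3 != 0 :> F -> sq (-1) -> u \in D ->
  (#|legendre_class u| * (generic_weight u + 4 * (u \in hexagonal)
     + (if sq 2%R then 2 else 3) * (u == -1)%R
     + (if sq 2%R then 2 else 3) * (u == 2)%R
     + (if sq 2%R then 2 else 6) * (u == 2^-1)%R) = 12)%N.
Proof.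
move=> three0 s1 hu; have clE := legendre_class_1mod4 s1 hu.
have N12 : -1 != 2 :> F by apply: (neq_factor (k := -1) three0); ring.
have N1h : -1 != 2^-1 :> F by apply: (neq_factor (k := - 2) three0); field.
have N2h : 2 != 2^-1 :> F by apply: (neq_factor (k := 2) three0); field.
have hexN1 : (-1 : F) \notin hexagonal.
  by rewrite inE (_ : _ + 1 = 3) //; ring.
have hex2 : (2 : F) \notin hexagonal.
  by rewrite inE (_ : _ + 1 = 3) //; ring.
have hexh : (2^-1 : F) \notin hexagonal.
  have four0 : 4 != 0 :> F by rewrite (_ : 4 = 2 * 2) ?mulf_neq0 //; ring.
  by rewrite inE (_ : _ + 1 = 3 / 4) ?mulf_neq0 ?invr_eq0 //; field; apply/andP.
have [uN1|uN1] := eqVneq u (-1).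
  rewrite /generic_weight uN1 subN1 s1 (negbTE hexN1) (negbTE N12) (negbTE N1h).
  rewrite uN1 subN1 s1 in clE.
  rewrite (@card_legendre_class _ ([:: -1; 2] ++ if sq 2 then [:: 2^-1] else [::])).
  - by case: (sq 2).
  - by case: (sq 2); rewrite /= !inE ?negb_or ?N12 ?N1h ?N2h.
  move=> v; rewrite clE invrN1 subN1 subhalf.
  by case: (sq 2); rewrite !inE; case: (v == -1); case: (v == 2); case: (v == 2^-1).
have [u2|u2] := eqVneq u 2.
  rewrite /generic_weight u2 sub12 s1 (negbTE hex2) (negbTE N2h).
  rewrite u2 sub12 s1 in clE.
  rewrite (@card_legendre_class _ ([:: -1; 2] ++ if sq 2 then [:: 2^-1] else [::])).
  - by case: (sq 2).
  - by case: (sq 2); rewrite /= !inE ?negb_or ?N12 ?N1h ?N2h.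
  move=> v; rewrite clE invrN1 subN1 subhalf.
  by case: (sq 2); rewrite !inE; case: (v == -1); case: (v == 2); case: (v == 2^-1).
have [uh|uh] := eqVneq u 2^-1.
  rewrite /generic_weight uh subhalf is_squareV (negbTE hexh).
  rewrite uh subhalf is_squareV invrK sub12 in clE.
  rewrite (@card_legendre_class _ (2^-1 :: if sq 2 then [:: -1; 2] else [::])).
  - by case: (sq 2).
  - by case: (sq 2); rewrite /= ?inE ?negb_or ?[2^-1 == _]eq_sym ?N12 ?N1h ?N2h.
  move=> v; rewrite clE.
  by case: (sq 2); rewrite !inE; case: (v == -1); case: (v == 2); case: (v == 2^-1).
rewrite !muln0 !addn0; case hex: (u \in hexagonal); last first.
  by rewrite addn0 card_legendre_class_1mod4 ?hex // generic_weightE.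
have [eV e1V] := hexagonalV hex.
have su : sq u.
  (* With [i^2 = -1] and [u^3 = -1], [(i * u^2)^2 = - u^4 = u]. *)
  have /existsP[i /eqP s1i] := s1; apply/existsP; exists (i * u ^+ 2).
  rewrite exprMn -s1i -subr_eq0 (_ : u - _ = (u ^+ 2 - u + 1) * (u ^+ 2 + u)); last by ring.
  by move: hex; rewrite inE mulf_eq0 => ->.
have su1 : sq (1 - u) by rewrite -eV is_squareV.
rewrite /generic_weight su su1 (@card_legendre_class _ [:: u; 1 - u]) //.
  have := card_hexagonal three0; rewrite (hexagonal_eq hex) cards2 /= mem_seq1 andbT.
  by case: (u != _) => -[].
move=> v; rewrite clE su su1 eV e1V subKr !inE.
by case: (v == u); case: (v == 1 - u).
Qed.

(** In characteristic 3, -1 = 2 = 1/2 and [u^2 - u + 1 = (u + 1)^2]: the only exception is -1, a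
    class of size 1 with generic weight 2. *)
Lemma legendre_class_weight_1mod4_char3 u : 3 = 0 :> F -> sq (-1) -> u \in D ->
  (#|legendre_class u| * (generic_weight u + 10 * (u == -1)%R) = 12)%N.
Proof.
move=> three0 s1 hu; have clE := legendre_class_1mod4 s1 hu.
have twoE : 2 = -1 :> F by rewrite -[RHS]addr0 -three0; ring.
have halfE : 2^-1 = -1 :> F by rewrite twoE invrN1.
have [uN1|uN1] := eqVneq u (-1).
  rewrite /generic_weight uN1 subN1 twoE s1.
  rewrite uN1 invrN1 subN1 halfE twoE subN1 twoE s1 in clE.
  rewrite (@card_legendre_class _ [:: -1]) // => v.
  by rewrite clE !inE; case: (v == -1).
rewrite muln0 addn0 card_legendre_class_1mod4 ?generic_weightE ?halfE // ?twoE //.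
rewrite inE (_ : _ + 1 = (u + 1) ^+ 2 - 3 * u); last by ring.
by rewrite three0 mul0r subr0 expf_eq0 addr_eq0.
Qed.

(** * Frequencies of the square patterns of [u] and [1 - u] *)

Definition square_pattern (a b : bool) : {set F} :=
  [set u in D | (sq u == a) && (sq (1 - u) == b)].

Lemma square_pattern_sub a b : #|square_pattern a b| = #|square_pattern b a|.
Proof.
have inj : injective (fun u : F => 1 - u) by exact: subrI.
rewrite -(card_imset _ inj); apply: eq_card => u; apply/imsetP/idP.
  by case=> v; rewrite inE => /andP[hv /andP[sv sv']] ->; rewrite inE paramsN subKr hv sv sv'.
rewrite inE => /andP[hu /andP[su su']]; exists (1 - u); last by rewrite subKr.
by rewrite inE paramsN subKr hu su su'.
Qed.

(** For a non-square [u], [1 - u^-1 = (u - 1) / u] has the character opposite to that of [1 - u], as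
    -1 is a square. *)
Lemma square_pattern_inv : sq (-1) ->
  #|square_pattern false true| = #|square_pattern false false|.
Proof.
move=> s1.
have H b : {in square_pattern false b, forall u, u^-1 \in square_pattern false (~~ b)}.
  move=> u; rewrite inE => /andP[hu /andP[su su1]].
  rewrite inE paramsV hu is_squareV su /=.
  have [u0 u1] : u != 0 /\ u != 1 by apply/andP; move: hu; rewrite inE.
  have -> : 1 - u^-1 = (u - 1) * u^-1 by field.
  rewrite is_squareM ?subr_eq0 ?invr_eq0 // is_squareV is_squareBC // s1 (eqP su) (eqP su1).
  by case: b {su1}.
have -> : square_pattern false false = GRing.inv @: square_pattern false true.
  apply/setP => u; apply/idP/imsetP => [hu|[v hv ->]]; last exact: (H true).
  by exists u^-1; rewrite ?invrK //; exact: (H false).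
by rewrite card_imset //; exact: invr_inj.
Qed.

(** Three patterns have size [(q - 1) / 4], and the pattern of two squares has [(q - 5) / 4]. *)
Lemma sum_generic_weight : (#|F| %% 4 = 1 ->
  2 * \sum_(u in D) generic_weight u + 11 = 7 * #|F|)%N.
Proof.
move=> q1; have s1 : sq (-1) by rewrite is_squareN1 // q1.
have NE a b : (\sum_(u in D) ((sq u == a) && (sq (1 - u)%R == b)) = #|square_pattern a b|)%N.
  exact: sum_nat_pred.
have gE : (\sum_(u in D) generic_weight u =
    2 * #|square_pattern true true| + 3 * #|square_pattern true false|
    + 3 * #|square_pattern false true| + 6 * #|square_pattern false false|)%N.
  rewrite -!NE !big_distrr -!big_split /=; apply: eq_bigr => u _.
  by rewrite /generic_weight; case: (sq u); case: (sq (1 - u)).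
have DE : (#|D| = #|square_pattern true true| + #|square_pattern true false|
    + #|square_pattern false true| + #|square_pattern false false|)%N.
  rewrite -!NE -!big_split /= -sum1_card; apply: eq_bigr => u _.
  by case: (sq u); case: (sq (1 - u)).
(* The last [.-1] removes the square 1, which is not a parameter. *)
have SE : (#|square_pattern true true| + #|square_pattern true false| = #|F|.-1./2.-1)%N.
  rewrite -!NE -!big_split /= -(card_squares qodd).
  rewrite (cardsD1 1) inE oner_neq0 is_square1 /=.
  rewrite -sum1_card [RHS]big_mkcond [LHS]big_mkcond; apply: eq_bigr => u _.
  rewrite !inE andbC; case: (u == 0); case: (u == 1); case: (sq u); by case: (sq (1 - u)).
have := square_pattern_sub true false; have := square_pattern_inv s1.
move: SE DE; rewrite gE card_params; move: q1 (finNzRing_gt1 F : (1 < #|F|)%N).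
move: #|F| #|square_pattern true true| #|square_pattern true false|
  #|square_pattern false true| #|square_pattern false false| => q a b c d; lia.
Qed.

(** The corrections at -1, 2, 1/2 add up to 6 or 12; doubled and combined with -11 they give 1 or
    13. *)
Lemma I_L_1mod4 : 3 != 0 :> F -> (#|F| %% 4 = 1 ->
  24 * I_L F = 7 * #|F| + (if sq 2%R then 1 else 13) + 8 * #|hexagonal|)%N.
Proof.
move=> three0 q1; have s1 : sq (-1) by rewrite is_squareN1 // q1.
have [DN1 D2 Dh] := special_params.
have := I_L_weight (fun u hu => legendre_class_weight_1mod4 three0 s1 hu).
rewrite 4!big_split /= -!big_distrr /= sum_hexagonal !sum_nat_pred1 //.
have := sum_generic_weight q1.
move: (\sum_(u in D) generic_weight u)%N (I_L F) #|F| #|hexagonal| => g i q t.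
by case: (sq 2); lia.
Qed.

Lemma I_L_1mod4_char3 : 3 = 0 :> F -> (#|F| %% 4 = 1 -> 24 * I_L F = 7 * #|F| + 9)%N.
Proof.
move=> three0 q1; have s1 : sq (-1) by rewrite is_squareN1 // q1.
have [DN1 _ _] := special_params.
have := I_L_weight (fun u hu => legendre_class_weight_1mod4_char3 three0 s1 hu).
rewrite big_split /= -big_distrr /= sum_nat_pred1 //.
have := sum_generic_weight q1.
move: (\sum_(u in D) generic_weight u)%N (I_L F) #|F| => g i q; lia.
Qed.

End Counting.

(* Closed formulas by the residue of [q] modulo 12 *)
Local Close Scope ring_scope.

Theorem mainTheorem5 (F : finFieldType) (p : nat)
  (hp : (p \in [pchar F])%R) (hp3 : 3 <= p) :
  let q := #|F| in
  [/\ q %% 12 = 1 -> I_L F = (7 * q + 29) %/ 24,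
      (q %% 12 = 3 \/ q %% 12 = 7) -> I_L F = (q + 2) %/ 3,
      (q %% 12 = 5 \/ q %% 12 = 9) -> I_L F = (7 * q + 13) %/ 24
    & q %% 12 = 11 -> I_L F = (q - 2) %/ 3].
Proof.
move=> q.
have two_neq0 : (2 != 0 :> F)%R by rewrite -(dvdn_pcharf hp) gtnNdvd.
have q1 : 1 < q := finNzRing_gt1 F.
(* The constant is 9 in characteristic 3, otherwise 1 or 13 plus 0 or 16. Divisibility by 24 leaves
   17 or 29 for [q = 1], 1 or 13 for [q = 5], and 9 for [q = 9] modulo 12. *)
have H1 : q %% 4 = 1 ->
  24 * I_L F = 7 * q + 9 \/ 24 * I_L F = 7 * q + 1 \/ 24 * I_L F = 7 * q + 13 \/
  24 * I_L F = 7 * q + 17 \/ 24 * I_L F = 7 * q + 29.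
  move=> q4; have qodd : odd q by lia.
  have [three0|three0] := eqVneq (3%R : F) 0%R; first by left; exact: I_L_1mod4_char3.
  right; rewrite (I_L_1mod4 two_neq0 qodd three0 q4) -/q.
  by case: (card_hexagonal three0) => ->; case: (is_square 2%R); lia.
(* Divisibility by 3 forces [t] to be 1, 2, 0 for [q = 3, 7, 11] modulo 12. *)
have H3 : q %% 4 = 3 -> exists2 t, t <= 2 & 3 * I_L F = q - 2 + 2 * t.
  move=> q3; exists #|@hexagonal F|; first exact: card_hexagonal_le2.
  by apply: I_L_3mod4 => //; rewrite -/q; lia.
move: (I_L F) q q1 H1 H3 => i q q1 H1 H3.
split=> [h|h|h|h].
- by have {}H1 := H1 ltac:(lia); lia.
- by have [t t2 e] := H3 ltac:(lia); lia.
- by have {}H1 := H1 ltac:(lia); lia.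
- by have [t t2 e] := H3 ltac:(lia); lia.
Qed.
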